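(* Let $n\in\mathbb{N}$ be odd. The non-empty subset sums of $\mathbb{Z}_n^{\times}$ are equally distributed modulo $n$. In particular, every residue class modulo $n$ appears exactly $\frac{2^{\varphi(n)}-1}{n}$ times among them.
   Context: $\mathbb{Z}_n^{\times}$ is the set of invertible elements of the ring $\mathbb{Z}_n=\mathbb{Z}/n\mathbb{Z}$, and $\varphi$ is Euler's totient function. The non-empty subset sums of $\mathbb{Z}_n^\times$ are the $2^{\varphi(n)}-1$ sums $\sum_{x\in B}x$ over non-empty $B\subseteq\mathbb{Z}_n^\times$, counted with multiplicity. They are equally distributed modulo $n$ if every residue class modulo $n$ occurs among them the same number of times. *)

(* Defs.v *)
From HB Require Import structures.
From mathcomp Require Import all_boot all_order all_algebra.

Set Implicit Arguments.
Unset Strict Implicit.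
Unset Printing Implicit Defensive.

Import Order.TTheory GRing.Theory Num.Theory.

(* The residues modulo n are the elements of 'I_n, with arithmetic taken
   %[mod n].  The type 'Z_n is not suitable, since 'Z_1 has two elements,
   whereas n = 1 is allowed here: in the zero ring, 0 = 1 is invertible. *)

Definition Zn_units (n : nat) : {set 'I_n} :=
  [set x : 'I_n | [exists y : 'I_n, x * y == 1 %[mod n]]].

Definition subset_sum_count (n : nat) (A : {set 'I_n}) (r : 'I_n) : nat :=
  #|[set B : {set 'I_n} |
      [&& B \subset A, B != set0 & \sum_(x in B) x == r %[mod n]]]|.

Definition equally_distributed (n : nat) (A : {set 'I_n}) : Prop :=
  forall r s : 'I_n, subset_sum_count A r = subset_sum_count A s.

(* Main.v *)
(** Let z be a primitive n-th root of unity. The number N_r of all subsets of the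
    unit group with sum r satisfies
      n N_r = \sum_(j < n) z^(-jr) \prod_u (1 + z^(ju)),
    u ranging over the units. When n does not divide j, w := z^j satisfies
    1 + w^u = (1 - w^(2u)) / (1 - w^u) with nonzero denominator, and u |-> 2u
    permutes the units because n is odd; so the product is 1. Hence
    n N_r = 2^totient n + \sum_(0 < j < n) z^(-jr) = 2^totient n - 1 + n [r = 0],
    and the last term accounts for the empty subset. *)

Require Import Defs.
From mathcomp Require Import all_boot all_order all_algebra.
From mathcomp Require Import cyclic algC cyclotomic.
Import GRing.Theory Num.Theory.
Local Open Scope ring_scope.

Lemma mem_Zn_units (n : nat) (x : 'I_n) : (x \in Zn_units n) = coprime x n.
Proof.
have n_gt0 : (0 < n)%N by apply: leq_ltn_trans (ltn_ord x).
rewrite inE; apply/existsP/idP => [[y /eqP xy1] | co_xn].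
  have: coprime (x * y) n by rewrite -coprime_modl xy1 coprime_modl coprime1n.
  by rewrite coprimeMl => /andP[].
(* By Euler's theorem, [x ^ (totient n).-1] is an inverse of [x]. *)
have lt_y : (x ^ (totient n).-1 %% n < n)%N by rewrite ltn_mod.
exists (Ordinal lt_y); rewrite /= modnMmr -expnS prednK ?totient_gt0 //.
exact/eqP/Euler_exp_totient.
Qed.

Lemma card_Zn_units (n : nat) : #|Zn_units n| = totient n.
Proof.
rewrite totient_count_coprime big_mkord -sum1_card big_mkcond.
by apply: eq_bigr => i _; rewrite mem_Zn_units coprime_sym; case: coprime.
Qed.

(** Geometric sum: multiplied by [z ^+ m - 1], it telescopes to [z ^+ (m * n) - 1 = 0]. *)
Lemma sum_prim_root_exp {F : fieldType} {n : nat} {z : F} (m : nat) :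
  n.-primitive_root z ->
  \sum_(j < n) z ^+ (j * m) = if (n %| m)%N then n%:R else 0.
Proof.
move=> z_prim; under eq_bigr => j _ do rewrite mulnC exprM.
case: ifPn => [|]; rewrite (prim_order_dvd z_prim) => zm1.
  by under eq_bigr => j _ do rewrite (eqP zm1) expr1n; rewrite sumr_const card_ord.
rewrite -subr_eq0 in zm1; apply: (mulfI zm1).
by rewrite mulr0 -subrX1 exprAC (prim_expr_order z_prim) expr1n subrr.
Qed.

Lemma sum_expr_subset_sum {R : comNzRingType} {T : finType} (A : {set T})
    (f : T -> nat) (w : R) :
  \sum_(B : {set T} | B \subset A) w ^+ (\sum_(x in B) f x)
    = \prod_(x in A) (1 + w ^+ f x).
Proof.
(* The value 0 off [A] kills every subset not contained in [A] when the product over all of [T] is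
   expanded. *)
pose F x := if x \in A then w ^+ f x else 0.
transitivity (\prod_x (F x + 1)); last first.
  rewrite [RHS]big_mkcond; apply: eq_bigr => x _; rewrite /F addrC.
  by case: ifP => // _; rewrite addr0.
rewrite bigA_distr big_mkcond; apply: eq_bigr => B _.
rewrite -big_mkcond /=; case: ifPn => [/subsetP sBA | /subsetPn[x Bx nAx]].
  by rewrite -prodrXr; apply: eq_bigr => x /sBA Ax; rewrite /F Ax.
by rewrite (bigD1 x) //= /F (negPf nAx) mul0r.
Qed.

(** The sum over [j] of [z ^+ (j * (n - r + s))] detects whether [s] is [r] modulo [n]; [n - r]
    plays the part of [-r] among natural exponents. *)
Lemma card_subset_sum_fourier {F : fieldType} {n : nat} {z : F}
    (A : {set 'I_n}) (r : 'I_n) : n.-primitive_root z ->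
  n%:R * #|[set B : {set 'I_n} | B \subset A
            & (\sum_(x in B) x == r %[mod n])%N]|%:R
    = \sum_(j < n) z ^+ (j * (n - r)) * \prod_(x in A) (1 + (z ^+ j) ^+ x).
Proof.
move=> z_prim; under eq_bigr => j _ do rewrite -sum_expr_subset_sum mulr_sumr.
rewrite exchange_big /= -sum1_card natr_sum mulr_sumr.
rewrite [LHS](eq_bigl (fun B : {set 'I_n} => (B \subset A) &&
   (\sum_(x in B) x == r %[mod n])%N)); last by move=> B; rewrite inE.
rewrite big_mkcondr; apply: eq_bigr => B _; rewrite mulr1.
under [RHS]eq_bigr => j _ do rewrite -exprM -exprD -mulnDr.
rewrite sum_prim_root_exp // -(eqn_modDl (n - r)) subnK 1?ltnW //.
by rewrite modnn.
Qed.

Lemma prod_Zn_units_1Dexp {F : fieldType} {n : nat} {w : F} :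
    odd n -> w ^+ n = 1 -> w != 1 ->
  \prod_(x in Zn_units n) (1 + w ^+ x) = 1.
Proof.
move=> n_odd wn1 w_neq1; have n_gt0 := odd_gt0 n_odd.
pose dbl (x : 'I_n) := Ordinal (ltn_pmod (2 * x) n_gt0).
have dbl_inj : injective dbl.
  (* For odd [n], [n.+1./2] is the inverse of 2 modulo [n]. *)
  have halveK (x : 'I_n) : ((2 * x %% n) * n.+1./2 %% n)%N = x.
    rewrite modnMml mulnAC mul2n even_halfK /= ?n_odd //.
    by rewrite mulnC mulnS addnC modnMDl modn_small.
  by move=> x y [eq_dbl]; apply: val_inj; rewrite /= -[LHS]halveK eq_dbl halveK.
(* If [y] inverts [x], then [w ^+ x = 1] would force [w = w ^+ (x * y) = 1]. *)
have w_unit x : x \in Zn_units n -> 1 - w ^+ x != 0.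
  rewrite inE => /existsP[y /eqP xy1]; rewrite subr_eq0 eq_sym.
  apply: contra w_neq1 => /eqP wx1; have := congr1 (GRing.exp w) xy1.
  by rewrite !expr_mod // exprM wx1 expr1n expr1 => <-.
set P := \prod_(x in Zn_units n) (1 - w ^+ x).
have P_neq0 : P != 0 by apply/prodf_neq0.
apply: (mulfI P_neq0); rewrite mulr1 -big_split /= [RHS](reindex_inj dbl_inj).
apply: eq_big => [x | x _] /=; last first.
  by rewrite expr_mod // mulnC exprM -subr_sqr expr1n.
by rewrite !mem_Zn_units coprime_modl coprimeMl coprime2n n_odd.
Qed.

(** The empty subset has sum 0, so it contributes exactly when [n] divides [r]. *)
Lemma card_subset_sum_split {n : nat} (A : {set 'I_n}) (r : 'I_n) :
  #|[set B : {set 'I_n} | B \subset A & (\sum_(x in B) x == r %[mod n])%N]|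
    = ((n %| r)%N + subset_sum_count A r)%N.
Proof.
rewrite (cardsD1 set0) inE sub0set big_set0 mod0n eq_sym; congr (_ + _)%N.
by apply: eq_card => B; rewrite !inE andbCA.
Qed.

Lemma mul_subset_sum_count_Zn_units {n : nat} (r : 'I_n) : odd n ->
  (n * subset_sum_count (Zn_units n) r).+1 = (2 ^ totient n)%N.
Proof.
move=> n_odd; have n_gt0 := odd_gt0 n_odd.
have [z z_prim] := C_prim_root_exists n_gt0.
have := card_subset_sum_fourier (Zn_units n) r z_prim.
have := sum_prim_root_exp (n - r) z_prim.
rewrite card_subset_sum_split (bigD1 (Ordinal n_gt0)) //= expr0 => sum_z.
rewrite (bigD1 (Ordinal n_gt0)) //= expr0 mul1r.
under eq_bigr do rewrite expr1n.
rewrite prodr_const card_Zn_units.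
rewrite (eq_bigr (fun j : 'I_n => z ^+ (j * (n - r)))) => [|j j_neq0]; last first.
  have zj_neq1 : z ^+ j != 1.
    by rewrite -(prim_order_dvd z_prim) /dvdn modn_small.
  have zjn1 : (z ^+ j) ^+ n = 1.
    by rewrite exprAC (prim_expr_order z_prim) expr1n.
  by rewrite prod_Zn_units_1Dexp ?mulr1.
(* The added 1 is the missing term [j = 0] of the root-of-unity sum. *)
move/(congr1 (+%R 1)); rewrite addrCA sum_z dvdn_subr ?dvdnn 1?ltnW //.
(* In this form the sum cancels against the contribution of the empty subset, whether or not [r] is
   0. *)
have -> : (if (n %| r)%N then n%:R else 0) = n%:R * (n %| r)%N%:R :> algC.
  by case: dvdn; rewrite ?mulr1 ?mulr0.
rewrite natrD mulrDr addrCA addrC => /addIr/eqP.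
by rewrite -natrM nat1r -[1 + 1]/2%:R -natrX eqr_nat => /eqP.
Qed.

Theorem theorem1p1 (n : nat) (n_odd : odd n) :
  equally_distributed (Zn_units n) /\
  forall r : 'I_n,
    (subset_sum_count (Zn_units n) r)%:R
      = (2 ^+ totient n - 1) / n%:R :> rat.
Proof.
have n_gt0 := odd_gt0 n_odd; split=> [r s | r].
  apply/eqP; rewrite -(eqn_pmul2l n_gt0) -eqSS.
  by rewrite !mul_subset_sum_count_Zn_units.
apply: canRL (mulfK _) _; first by rewrite pnatr_eq0 -lt0n.
rewrite -natrX -(mul_subset_sum_count_Zn_units r n_odd) -natr1 addrK.
by rewrite -natrM mulnC.
Qed.
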